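(* Let $(\mathfrak{g},\omega)$ be a flat symplectic Lie algebra. Then the derived ideal $[\mathfrak{g},\mathfrak{g}]$ is degenerate with respect to $\omega$, i.e. $[\mathfrak{g},\mathfrak{g}]\cap[\mathfrak{g},\mathfrak{g}]^\perp\neq\{0\}$.
   Context: A symplectic Lie algebra $(\mathfrak{g},\omega)$ is a finite-dimensional real Lie algebra $\mathfrak{g}$ with a non-degenerate skew-symmetric bilinear form $\omega$ such that $\omega([u,v],w)+\omega([v,w],u)+\omega([w,u],v)=0$ for all $u,v,w\in\mathfrak{g}$. Its associated product $\bullet$ is defined by $\omega(u\bullet v,w)=\frac13\big(\omega([u,v],w)+\omega([u,w],v)\big)$ for all $u,v,w$; put $\mathrm{L}_uv=u\bullet v$. $(\mathfrak{g},\omega)$ is called flat if $\mathrm{L}_{[u,v]}=\mathrm{L}_u\mathrm{L}_v-\mathrm{L}_v\mathrm{L}_u$ for all $u,v\in\mathfrak{g}$. For a subspace $F$, $F^\perp=\{x\in\mathfrak{g}: \omega(x,y)=0\ \forall y\in F\}$; $F$ is degenerate if $F\cap F^\perp\neq\{0\}$.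
   Formalization: The Lie algebra is additionally assumed to be non-abelian; for an abelian symplectic Lie algebra, which is always flat, the derived ideal is {0} and the claim fails. *)

(* Defs.v *)
From HB Require Import structures.
From mathcomp Require Import all_boot all_order all_algebra.
From mathcomp Require Import reals.

Set Implicit Arguments.
Unset Strict Implicit.
Unset Printing Implicit Defensive.

Import Order.TTheory GRing.Theory Num.Theory.

Local Open Scope ring_scope.

Section SymplecticLieAlgebra.

Variables (R : realType) (g : vectType R).
Variables (br : {bilinear g -> g -> g}) (om : {skew_symmetric g}).

Implicit Types (u v w x y : g) (U : {vspace g}).

Definition is_lie_bracket : Prop :=
  (forall u, br u u = 0) /\
  (forall u v w, br u (br v w) + br v (br w u) + br w (br u v) = 0).

Definition is_abelian : Prop := forall u v, br u v = 0.

(* Spanned by the brackets of basis vectors; see [memv_derived] and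
   [derived_subvP] for the basis-free description. *)
Definition derived : {vspace g} :=
  <<[seq br x y | x <- vbasis {:g}, y <- vbasis {:g}]>>%VS.

Definition is_symplectic_lie_algebra : Prop :=
  [/\ is_lie_bracket,
      nondegenerate om &
      forall u v w, om (br u v) w + om (br v w) u + om (br w u) v = 0].

Definition form_lfun : 'Hom(g, 'Hom(g, R^o)) :=
  linfun (fun u => linfun (om u : g -> R^o)).

(* The vector u • v is the preimage, under the isomorphism x |-> om x _ of g
   with its dual, of the linear form characterised in [assoc_prodE]. *)
Definition assoc_prod u v : g :=
  (form_lfun^-1)%VF
    (linfun (fun w => 3^-1 * (om (br u v) w + om (br u w) v) : R^o)).

Definition is_flat : Prop :=
  forall u v w, assoc_prod (br u v) w =
    assoc_prod u (assoc_prod v w) - assoc_prod v (assoc_prod u w).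

Definition is_degenerate U : Prop := (U :&: orthov om U)%VS <> 0%VS.

Lemma memv_derived u v : br u v \in derived.
Proof.
rewrite (coord_vbasis (memvf u)) (coord_vbasis (memvf v)).
rewrite linear_sumlz; apply: memv_suml => i _.
rewrite linear_sumr; apply: memv_suml => j _.
rewrite linearZl_LR linearZr_LR !memvZ // memv_span //.
by apply/allpairsP; exists ((vbasis {:g})`_i, (vbasis {:g})`_j);
  rewrite !mem_nth ?size_tuple.
Qed.

Lemma derived_subvP U :
  reflect (forall u v, br u v \in U) (derived <= U)%VS.
Proof.
apply: (iffP idP) => [/subvP sDU u v|brU]; first exact/sDU/memv_derived.
by apply/span_subvP => _ /allpairsP[[u v] /= [_ _ ->]].
Qed.

Lemma form_lfunE u v : form_lfun u v = om u v.
Proof.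
pose f u : 'Hom(g, R^o) := linfun (om u : g -> R^o).
have f_lin : linear f.
  move=> a x y; apply/lfunP => w.
  by rewrite add_lfunE scale_lfunE !lfunE /= linearPl.
pose fL := GRing.isLinear.Build _ _ _ _ f f_lin.
pose F : {linear g -> 'Hom(g, R^o)} := HB.pack f fL.
by rewrite /form_lfun (lfunE F) lfunE.
Qed.

Lemma assoc_prodE u v w : nondegenerate om ->
  om (assoc_prod u v) w = 3^-1 * (om (br u v) w + om (br u w) v).
Proof.
move=> om_nd; rewrite -form_lfunE /assoc_prod.
pose h w : R^o := 3^-1 * (om (br u v) w + om (br u w) v).
have h_lin : linear h.
  move=> a x y; rewrite /h !linearPr linearPl /=.
  by rewrite addrACA -mulrDr (mulrDr 3^-1 (a * _)) mulrCA.
pose hL := GRing.isLinear.Build _ _ _ _ h h_lin.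
pose H : {linear g -> R^o} := HB.pack h hL.
have ker0 : lker form_lfun == 0%VS.
  rewrite -subv0 -(eqP om_nd); apply/subvP => x; rewrite memv_ker => /eqP x0.
  by apply/mem_orthovP => y _; rewrite -form_lfunE x0 lfunE.
rewrite limg_lfunVK; first exact: (lfunE H).
have -> : limg form_lfun = fullv; last exact: memvf.
apply/eqP; rewrite -dimv_leqif_eq ?subvf // limg_dim_eq ?(eqP ker0) ?capv0 //.
by rewrite !dimvf /dim /= muln1.
Qed.

End SymplecticLieAlgebra.

(* Main.v *)
(* Write L w = x • w and R w = w • x. With respect to om the operator L is skew
   and the adjoint of R is the Jordan multiplication L + R. Pairing the
   left-symmetry of the flat product with om therefore yields a second family
   of cubic identities, and together they give x • (x • x) = 0, L^3 = 0,
   R^2 = RL - 2LR - L^2, RLR = -L^2 R - L^3 and ad_x^2 = -3LR, so ad_x^4 = 0.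
   By Engel's theorem a nonzero derived ideal contains a nonzero central
   element, and the cocycle identity puts central elements in the orthogonal
   of the derived ideal. *)
Require Import Defs.
From mathcomp Require Import all_boot all_order all_algebra.
From mathcomp Require Import reals.
From mathcomp Require Import lra.

Import GRing.Theory.

Local Open Scope ring_scope.

Lemma alternate_anti (F : fieldType) (g : vectType F)
    (br : {bilinear g -> g -> g}) :
  (forall u, br u u = 0) -> forall u v, br u v = - br v u.
Proof.
move=> alt u v; apply/eqP; rewrite -addr_eq0; have /eqP := alt (u + v).
by rewrite linearDl /= !linearDr /= !alt add0r addr0.
Qed.

(** * Engel's theorem for nilpotent adjoint maps *)

Section Engel.

Variables (F : fieldType) (g : vectType F) (br : {bilinear g -> g -> g}).

Hypothesis br_alt : forall u, br u u = 0.
Hypothesis br_jacobi :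
  forall u v w, br u (br v w) + br v (br w u) + br w (br u v) = 0.
Hypothesis ad_nilp : forall x, exists n, forall w, iter n (br x) w = 0.

Let stable (H V : {vspace g}) : Prop :=
  forall u v, u \in H -> v \in V -> br u v \in V.

(** Engel's common null vector in V / (V ∩ W), phrased without quotient spaces. *)
Let engel (H : {vspace g}) := forall V W : {vspace g},
  stable H V -> stable H W -> ~~ (V <= W)%VS ->
  exists v, [/\ v \in V, v \notin W & forall u, u \in H -> br u v \in W].

Let br_anti := alternate_anti F g br br_alt.

Lemma br_derivation u v w : br u (br v w) = br (br u v) w + br v (br u w).
Proof.
rewrite (br_anti (br u v)) (br_anti u w) linearNr /=; apply/eqP.
by rewrite -opprD -addr_eq0 (addrC (br w _)) addrA br_jacobi.
Qed.

(** Start from a vector of V outside W that H sends into W. As x normalises H, its iterates under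
    [br x] are also sent into W by H; the last one before the first to enter W is sent there by x
    too. *)
Lemma engel_add_line (H : {vspace g}) x :
  (forall h, h \in H -> br h x \in H) -> engel H -> engel (H + <[x]>).
Proof.
move=> nHx engH V W sV sW sVW.
have sHHx : (H <= H + <[x]>)%VS := addvSl _ _.
have [||v0 [v0V v0W Hv0]] := engH V W _ _ sVW.
- by move=> h v Hh; apply/sV/(subvP sHHx).
- by move=> h v Hh; apply/sW/(subvP sHHx).
have xHx : x \in (H + <[x]>)%VS by rewrite (subvP (addvSr _ _)) ?memv_line.
have iterP k : iter k (br x) v0 \in V /\
    (forall h, h \in H -> br h (iter k (br x) v0) \in W).
  elim: k => // k [IHV IHW]; split=> [|h Hh] /=; first by apply: sV.
  by rewrite br_derivation memvD ?IHW ?nHx //; apply: sW; rewrite ?IHW.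
have [n /(_ v0) nil_n] := ad_nilp x.
have exk : exists k, iter k (br x) v0 \in W by exists n; rewrite nil_n mem0v.
case: (ex_minnP exk) => -[|k] Wk min_k; first by rewrite Wk in v0W.
exists (iter k (br x) v0); have [Vk Hk] := iterP k; split=> //.
  by apply/negP => /min_k; rewrite ltnn.
move=> _ /memv_addP[h Hh [_ /vlineP[c ->] ->]].
by rewrite linearDl /= linearZl_LR memvD ?memvZ // Hk.
Qed.

Lemma engel_subalgebra d : (d <= \dim {:g})%N ->
  exists H : {vspace g}, [/\ \dim H = d, stable H H & engel H].
Proof.
elim: d => [_|d IHd lt_d].
  exists 0%VS; split; first exact: dimv0.
    by move=> u v /vlineP[c ->] _; rewrite scaler0 linear0l mem0v.
  move=> V W _ _ /subvPn[v vV vW]; exists v; split=> // u.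
  by rewrite memv0 => /eqP->; rewrite linear0l mem0v.
have [H [dimH sH engH]] := IHd (ltnW lt_d).
(* Modulo H itself, the null vector is an x outside H that normalises H. *)
have [|//||x [_ xH nHx]] := engH fullv H.
- by move=> *; apply: memvf.
- by rewrite -dimH in lt_d; apply/negP => /dimvS; rewrite leqNgt lt_d.
exists (H + <[x]>)%VS; split; last exact: engel_add_line.
  have x0 : x != 0 by apply: contraNneq xH => ->; apply: mem0v.
  rewrite dimv_disjoint_sum ?dim_vline ?x0 ?addn1 ?dimH //.
  apply/eqP; rewrite -subv0; apply/subvP => y /memv_capP[yH /vlineP[c yE]].
  have [c0|c0] := eqVneq c 0; first by rewrite yE c0 scale0r mem0v.
  by case/negP: xH; rewrite -(scale1r x) -(mulVf c0) -scalerA -yE memvZ.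
move=> u v /memv_addP[h Hh [_ /vlineP[c ->] ->]].
move=> /memv_addP[k Hk [_ /vlineP[e ->] ->]].
(* Since [x, x] = 0, the bracket already lies in H. *)
apply: (subvP (addvSl _ _)); rewrite linearDl /= !linearDr /= !linearZl_LR.
rewrite !linearZr_LR br_alt !scaler0 addr0 (br_anti x); apply: memvD.
  by apply: memvD; [apply: sH | apply/memvZ/nHx].
by apply: memvZ; rewrite memvN nHx.
Qed.

Theorem engel_central (I : {vspace g}) :
  (forall u v, v \in I -> br u v \in I) -> I != 0%VS ->
  exists v, [/\ v \in I, v != 0 & forall u, br u v = 0].
Proof.
move=> sI I0; have [H [dimH _ engH]] := engel_subalgebra _ (leqnn _).
have HT u : u \in H.
  suff -> : H = fullv by apply: memvf.
  by apply/eqP; rewrite eqEdim subvf dimH leqnn.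
have [|||v [vI v0 cv]] := engH I 0%VS.
- by move=> u v _; apply: sI.
- by move=> u v _; rewrite memv0 => /eqP->; rewrite linear0r mem0v.
- by rewrite subv0.
exists v; split=> // [|u]; first by rewrite memv0 in v0.
by apply/eqP; rewrite -memv0 cv.
Qed.

End Engel.

(** * The associated product and its adjoints *)

Section FlatSymplectic.

Variables (R : realType) (g : vectType R).
Variables (br : {bilinear g -> g -> g}) (om : {skew_symmetric g}).
Hypothesis sympl : is_symplectic_lie_algebra br om.

Local Notation "x • y" := (assoc_prod br om x y)
  (at level 40, left associativity).

Lemma omC u v : om u v = - om v u.
Proof. by rewrite hermC /= expr1 mulN1r. Qed.

(** Reduces identities in g to scalar ones, which [lra] can combine. *)
Lemma om_injl u v : (forall w, om u w = om v w) -> u = v.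
Proof.
case: sympl => _ /eqP om_nd _ uv; apply/eqP; rewrite -subr_eq0 -memv0 -om_nd.
by apply/mem_orthovP => w _; rewrite linearBl /= uv subrr.
Qed.

Lemma om_prodE u v w : om (u • v) w = 3^-1 * (om (br u v) w + om (br u w) v).
Proof. by case: sympl => _ om_nd _; apply: assoc_prodE. Qed.

Let br_anti : forall u v, br u v = - br v u.
Proof. by case: sympl => -[alt _] _ _; apply: alternate_anti. Qed.

Lemma omDl u v w : om (u + v) w = om u w + om v w.
Proof. exact: linearDl. Qed.

Lemma omDr u v w : om w (u + v) = om w u + om w v.
Proof. exact: linearDr. Qed.

Lemma omNl u v : om (- u) v = - om u v.
Proof. exact: linearNl. Qed.

Lemma omNr u v : om v (- u) = - om v u.
Proof. exact: linearNr. Qed.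

Let omE := (omDl, omDr, omNl, omNr).

Lemma prodDl u v w : (u + v) • w = u • w + v • w.
Proof. by apply: om_injl => z; rewrite !omE !om_prodE !linearDl ?omE; lra. Qed.

Lemma prodDr u v w : u • (v + w) = u • v + u • w.
Proof. by apply: om_injl => z; rewrite !omE !om_prodE !linearDr ?omE; lra. Qed.

Lemma prodNl u v : (- u) • v = - (u • v).
Proof. by apply: om_injl => z; rewrite !omE !om_prodE !linearNl ?omE; lra. Qed.

Lemma prodNr u v : u • (- v) = - (u • v).
Proof. by apply: om_injl => z; rewrite !omE !om_prodE !linearNr ?omE; lra. Qed.

Lemma prod0r u : u • 0 = 0.
Proof. by apply: (addrI (u • 0)); rewrite -prodDr !addr0. Qed.

Lemma prod_torsion_free u v : u • v - v • u = br u v.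
Proof.
apply: om_injl => z; have [_ _ /(_ u v z) cocycle] := sympl.
move: cocycle; rewrite !omE !om_prodE (br_anti v u) (br_anti z u) !omE.
lra.
Qed.

(** The formula defining the product is symmetric in v and w. *)
Lemma om_prod_skew u v w : om (u • v) w = - om v (u • w).
Proof. rewrite (omC v) !om_prodE; lra. Qed.

Lemma om_prod_adj u v w : om (u • v) w = om u (v • w + w • v).
Proof.
rewrite (omC u) !omE !om_prodE (br_anti w v) (br_anti w u) (br_anti v u).
rewrite !omE; lra.
Qed.

(** * Operator identities in the flat case *)

Hypothesis flat : is_flat br om.

Lemma prod_left_sym x y w :
  x • (w • y) - (x • w) • y = w • (x • y) - (w • x) • y.
Proof.
have := flat x w y; rewrite -prod_torsion_free prodDl prodNl => flatE.
apply: om_injl => z; have := congr1 (om^~ z) flatE; rewrite /= !omE; lra.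
Qed.

Let prodE := (prodDl, prodDr, prodNl, prodNr).

(** Left-symmetry, read as an identity between operators acting on its middle factor z, is replaced
    by its adjoint. *)
Lemma prod_left_sym_adj x y v :
  x • (y • v + v • y) - (y • (x • v) + (x • v) • y) =
  (x • y) • v + v • (x • y) - (x • (y • v + v • y) + (y • v + v • y) • x).
Proof.
apply: om_injl => z; have := congr1 (om^~ v) (prod_left_sym x y z).
rewrite /= !omE (om_prod_skew x (z • y)) (om_prod_adj z y) (om_prod_adj _ y v).
rewrite (om_prod_skew x z) (om_prod_adj z (x • y)) (om_prod_adj (z • x)).
rewrite (om_prod_adj z x) !(omC z) !prodE !omE; lra.
Qed.

(** Left-symmetry expands one copy of y • (x • w + w • x) in the adjoint identity and cancels every
    term with an inner y • x or y • w. *)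
Lemma prod_jordan x y w :
  (x • y) • w + (w • y) • x = y • (x • w + w • x) + (x • w + w • x) • y.
Proof.
apply: om_injl => z.
have := congr1 (om^~ z) (prod_left_sym_adj y x w).
have := congr1 (om^~ z) (prod_left_sym y x w).
have := congr1 (om^~ z) (prod_left_sym y w x).
rewrite /= !prodE !omE; lra.
Qed.

Lemma prod_cube x : x • (x • x) = 0.
Proof.
apply: om_injl => z; have := congr1 (om^~ z) (prod_jordan x x x).
rewrite /= linear0l !prodE !omE; lra.
Qed.

(** Eliminate w • (x • x) and (x • x) • w from the three instances below. *)
Lemma prod_quadratic x w :
  (w • x) • x = (x • w) • x - x • (w • x) - x • (w • x) - x • (x • w).
Proof.
apply: om_injl => z; have := congr1 (om^~ z) (prod_left_sym x x w).
have := congr1 (om^~ z) (prod_jordan x w x).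
have := congr1 (om^~ z) (prod_jordan x x w).
rewrite /= !prodE !omE; lra.
Qed.

Lemma prod_sqr x w : w • (x • x) = - (x • (x • w)) - x • (w • x).
Proof.
apply: om_injl => z; have := congr1 (om^~ z) (prod_left_sym x x w).
have := congr1 (om^~ z) (prod_quadratic x w).
rewrite /= ?prodE !omE; lra.
Qed.

(** Left-symmetry for x • x, with [prod_sqr], gives LRL = 2L^2 R + LR^2; substituting for R^2 leaves
    L^3 = 0. *)
Lemma prod_left_cube x w : x • (x • (x • w)) = 0.
Proof.
apply: om_injl => z; have := congr1 (om^~ z) (prod_left_sym x (x • x) w).
have := congr1 (fun v => om (x • v) z) (prod_quadratic x w).
rewrite /= prod_cube prod0r !prod_sqr !prodE !omE !linear0l; lra.
Qed.

(** Compare R^3 computed as R^2 R and as R R^2. *)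
Lemma prod_rlr x w :
  (x • (w • x)) • x = - (x • (x • (w • x))) - x • (x • (x • w)).
Proof.
apply: om_injl => z.
have := congr1 (om^~ z) (prod_quadratic x (w • x)).
have := congr1 (om^~ z) (prod_quadratic x (x • w)).
have := congr1 (fun v => om (v • x) z) (prod_quadratic x w).
have := congr1 (fun v => om (x • v) z) (prod_quadratic x w).
rewrite /= !prodE !omE; lra.
Qed.

Lemma br_sqr x w :
  br x (br x w) = - (x • (w • x)) - x • (w • x) - x • (w • x).
Proof.
apply: om_injl => z; rewrite -!prod_torsion_free.
have := congr1 (om^~ z) (prod_quadratic x w).
rewrite /= !prodE !omE; lra.
Qed.

(** Here ad_x^4 = 9 LRLR, and LRLR = -L^3 R - L^4 vanishes. *)
Lemma ad_nilp4 x w : iter 4 (br x) w = 0.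
Proof.
have LRLR v : x • ((x • (v • x)) • x) = 0.
  by rewrite prod_rlr !prodE !prod_left_cube oppr0 addr0.
by rewrite /= 2!br_sqr !prodE !LRLR !(oppr0, addr0).
Qed.

End FlatSymplectic.

Theorem proposition2p6 (R : realType) (g : vectType R)
    (br : {bilinear g -> g -> g}) (om : {skew_symmetric g}) :
  is_symplectic_lie_algebra br om ->
  is_flat br om ->
  ~ is_abelian br ->
  is_degenerate om (derived br).
Proof.
move=> sympl flat nab; have [[alt jacobi] _ cocycle] := sympl.
have ad_nilp x : exists n, forall w, iter n (br x) w = 0.
  by exists 4 => w; apply: (ad_nilp4 R g br om).
have [||c [cD c0 cZ]] := engel_central R g br alt jacobi ad_nilp (derived br).
- by move=> u v _; apply: memv_derived.
- apply/eqP => D0; apply: nab => u v; apply/eqP.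
  by rewrite -memv0 -D0 memv_derived.
have c_orth : c \in orthov om (derived br).
  (* Swapping sides makes the goal an inclusion of the derived ideal in the orthogonal of c, to be
     tested on single brackets. *)
  rewrite mem_orthov_sym; apply/derived_subvP => u v; apply/mem_orthovP.
  move=> _ /vlineP[k ->]; rewrite linearZr /=.
  have := cocycle u v c; rewrite (alternate_anti _ _ _ alt c u) !cZ oppr0.
  by rewrite !linear0l !addr0 => ->; rewrite mulr0.
move=> I0; case/negP: c0.
by rewrite -memv0 -I0 memv_cap cD.
Qed.
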